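(* Let $U$ be a quantitative equational theory over a signature $(\Omega,\mathrm{ar})$, let $T_U\colon\mathsf{Met}\to\mathsf{Met}$ be the metric term monad it induces, and let $n\ge 0$. (1) The assignment $A\mapsto PH_n(T_UA)$ is a functor $PH^U_n\colon\mathsf{Met}\to\mathsf{Ab}^{([0,\infty),\le)}$, namely the composite $$\mathsf{Met}\xrightarrow{T_U}\mathsf{Met}\xrightarrow{N(-)^{\le -}}\mathsf{sSet}^{([0,\infty),\le)}\xrightarrow{H_nC_\bullet}\mathsf{Ab}^{([0,\infty),\le)}.$$ (2) For every $A$ in $\mathsf{Met}$ and every $\ell\in[0,\infty)$ the $n$-th homology of the associated graded complex $\mathrm{gr}_\ell C_\bullet(T_UA)=F_\ell C_\bullet(T_UA)/F_{<\ell}C_\bullet(T_UA)$ is the magnitude homology $MH_{n,\ell}(T_UA)$ of the free algebra, naturally in $A$.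
   Context: Metric spaces. An extended metric space is a set $X$ with $d\colon X\times X\to[0,\infty]$ that is zero on the diagonal, symmetric, satisfies the triangle inequality, and has $d(x,y)=0\Rightarrow x=y$. $\mathsf{Met}$ is the category of these with nonexpansive maps. Syntax. A signature is a finite set $\Omega$ of operation symbols with an arity map $\mathrm{ar}\colon\Omega\to\mathbb{N}$; $\Omega_n=\mathrm{ar}^{-1}\{n\}$. $\Xi$ is a fixed countably infinite set of variables, $T_\Omega\Xi$ the set of $\Omega$-terms over $\Xi$. A substitution is a map $\sigma\colon\Xi\to T_\Omega\Xi$, extended to terms as the $\Omega$-homomorphism $\sigma^\sharp$. A quantitative equation $t=_\varepsilon s$ is a triple $(t,\varepsilon,s)\in\mathcal{E}=T_\Omega\Xi\times\mathbb{Q}_{\ge0}\times T_\Omega\Xi$. A quantitative inference is an element $(\Gamma,\varphi)$ of $\mathcal{I}=\mathcal{P}_{\mathrm{fin}}(\mathcal{E})\times\mathcal{E}$; it is basic if all equations of $\Gamma$ relate variables only. A deducibility relation is a relation ${\vdash}\subseteq 2^{\mathcal{E}}\times\mathcal{E}$ (arbitrary hypothesis sets) closed under, for all terms, $f\in\Omega_n$, $\varepsilon,\varepsilon'\in\mathbb{Q}_{\ge 0}$: $\varnothing\vdash t=_0t$; $\{t=_\varepsilon s\}\vdash s=_\varepsilon t$; $\{t=_\varepsilon s,s=_{\varepsilon'}u\}\vdash t=_{\varepsilon+\varepsilon'}u$; $\{t=_\varepsilon s\}\vdash t=_{\varepsilon+\varepsilon'}s$ for $\varepsilon'>0$; $\{t=_{\varepsilon'}s\mid\varepsilon'>\varepsilon\}\vdash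 t=_\varepsilon s$; $\{t_i=_\varepsilon s_i\mid 1\le i\le n\}\vdash f(t_1,\dots,t_n)=_\varepsilon f(s_1,\dots,s_n)$; $\Gamma\vdash t=_\varepsilon s$ implies $\sigma^\sharp\Gamma\vdash\sigma^\sharp t=_\varepsilon\sigma^\sharp s$ for every substitution $\sigma$; if $\Gamma\vdash\varphi$ for all $\varphi\in\Gamma'$ and $\Gamma'\vdash\psi$ then $\Gamma\vdash\psi$; $\varphi\in\Gamma$ implies $\Gamma\vdash\varphi$. For a set $S$ of basic inferences, $\vdash_S$ is the least deducibility relation containing $S$, and the quantitative equational theory induced by $S$ is $U=({\vdash_S})\cap\mathcal{I}$. A quantitative equational theory is one of this form. Semantics. A quantitative algebra is an $\Omega$-algebra $A$ with an extended metric $d^A$ such that for every $f\in\Omega_n$: if $d^A(a_i,b_i)\le\varepsilon$ for all $i$ then $d^A(f^A(a_1,\dots,a_n),f^A(b_1,\dots,b_n))\le\varepsilon$. It satisfies $(\Gamma,t=_\varepsilon s)$ if every assignment $\iota\colon\Xi\to A$ (extended to terms as the homomorphism $\iota^\sharp$) with $d^A(\iota^\sharp t',\iota^\sharp s')\le\varepsilon'$ for all $(t'=_{\varepsilon'}s')\in\Gamma$ has $d^A(\iota^\sharp t,\iota^\sharp s)\le\varepsilon$. Morphisms of quantitative algebras are nonexpansive $\Omega$-homomorphisms; $\mathrm{Mod}(U)$ is the full subcategory of quantitative algebras satisfying every inference in $U$. It is a known theorem (Mardare–Panangaden–Plotkin) that the forgetful functor $G_U\colon\mathrm{Mod}(U)\to\mathsf{Met}$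 has a left adjoint $\mathrm{Free}_U$; the metric term monad is the induced monad $T_U=G_U\mathrm{Free}_U$ on $\mathsf{Met}$. Homology. For $X$ in $\mathsf{Met}$, $N(X)$ is the simplicial set with $N(X)_n$ all tuples $\langle x_0,\dots,x_n\rangle$ of points of $X$, the face $d_i$ deleting $x_i$ and the degeneracy $s_i$ repeating it; $\lambda\langle x_0,\dots,x_n\rangle=\sum_{i=1}^nd(x_{i-1},x_i)$. $N(X)^{\le\ell}\subseteq N(X)$, $\ell\in[0,\infty)$, is the simplicial subset of simplices with $\lambda\le\ell$; a nonexpansive $F$ with underlying map $f$ acts by $\langle x_0,\dots,x_n\rangle\mapsto\langle fx_0,\dots,fx_n\rangle$. $C_\bullet$ denotes the normalised chain complex (simplicial chains over $\mathbb{Z}$ modulo degenerate simplices) and $H_nC_\bullet$ is applied pointwise in $\ell$. $C_\bullet(X)=C_\bullet(N(X))$, $F_\ell C_\bullet(X)=C_\bullet(N(X)^{\le\ell})\subseteq C_\bullet(X)$, $F_{<\ell}C_\bullet(X)=\bigcup_{\ell'<\ell}F_{\ell'}C_\bullet(X)$. $PH_n(X)\colon([0,\infty),\le)\to\mathsf{Ab}$ is $\ell\mapsto H_n(F_\ell C_\bullet(X))$ with transition maps induced by inclusions. Magnitude homology is $MH_{n,\ell}(X)=H_n(MC_{\bullet,\ell}(X))$ with $MC_{\bullet,\ell}(X)=F_\ell C_\bullet(X)/F_{<\ell}C_\bullet(X)$; on a nonexpansive map it is the induced map, so that the naturality in (2) refers to the functor $A\mapsto MH_{n,\ell}(T_UA)$,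 $\mathsf{Met}\to\mathsf{Ab}$. *)

(* Defs.v *)
From HB Require Import structures.
From mathcomp Require Import all_boot all_order all_algebra zify.
From mathcomp Require Import generic_quotient ring_quotient interval_inference.
From mathcomp Require Import boolp classical_sets cardinality.
From mathcomp Require Import reals constructive_ereal ereal.
From mathcomp Require Import freeg.

Set Implicit Arguments.
Unset Strict Implicit.
Unset Printing Implicit Defensive.

Import Order.TTheory GRing.Theory Num.Theory.

Local Open Scope classical_set_scope.
Local Open Scope ring_scope.
Local Open Scope quotient_scope.

Record category := Category {
  obj :> Type;
  hom : obj -> obj -> Type;
  idm : forall A, hom A A;
  cmp : forall A B C, hom B C -> hom A B -> hom A C;
  cmp_idl : forall A B (f : hom A B), cmp (idm B) f = f;
  cmp_idr : forall A B (f : hom A B), cmp f (idm A) = f;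
  cmpA : forall A B C D (h : hom C D) (g : hom B C) (f : hom A B),
    cmp h (cmp g f) = cmp (cmp h g) f }.

Arguments hom {_} _ _.
Arguments idm {_} _.
Arguments cmp {_ _ _ _} _ _.

Record is_functor (C D : category) (F0 : C -> D)
    (F1 : forall A B : C, hom A B -> hom (F0 A) (F0 B)) : Prop := IsFunctor {
  functor_id : forall A, F1 A A (idm A) = idm (F0 A);
  functor_cmp : forall A B E (g : hom B E) (f : hom A B),
    F1 A E (cmp g f) = cmp (F1 B E g) (F1 A B f) }.

Record functor (C D : category) := Functor {
  fobj :> C -> D;
  fmap : forall A B, hom A B -> hom (fobj A) (fobj B);
  fmapP : is_functor fmap }.

Arguments fmap {_ _} _ {_ _} _.

Section FunctorOps.
Variables (C D E : category).

Lemma id_functor_subproof : @is_functor C C id (fun _ _ f => f).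
Proof. by []. Qed.
Definition id_functor : functor C C := Functor id_functor_subproof.

Lemma comp_functor_subproof (G : functor D E) (F : functor C D) :
  @is_functor C E (G \o F) (fun _ _ f => fmap G (fmap F f)).
Proof.
split=> [A|A B A' g f].
  by rewrite (functor_id (fmapP F)) (functor_id (fmapP G)).
by rewrite (functor_cmp (fmapP F)) (functor_cmp (fmapP G)).
Qed.
Definition comp_functor (G : functor D E) (F : functor C D) : functor C E :=
  Functor (comp_functor_subproof G F).
End FunctorOps.

Notation "G \O F" := (comp_functor G F)
  (at level 40, left associativity) : function_scope.
Local Open Scope function_scope.

Record nattrans (C D : category) (F G : functor C D) := NatTrans {
  ntmap :> forall A, hom (F A) (G A);
  ntmapP : forall A B (f : hom A B),
    cmp (ntmap B) (fmap F f) = cmp (fmap G f) (ntmap A) }.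

Lemma nattrans_ext C D (F G : functor C D) (a b : nattrans F G) :
  (forall A, a A = b A) -> a = b.
Proof.
case: a b => [a aP] [b bP] /= ab.
have {}ab : a = b by apply: functional_extensionality_dep.
by rewrite -ab in bP *; congr NatTrans; apply: Prop_irrelevance.
Qed.

Definition is_iso (C : category) (A B : C) (f : hom A B) : Prop :=
  exists g : hom B A, cmp g f = idm A /\ cmp f g = idm B.

Definition is_natiso C D (F G : functor C D) (a : nattrans F G) : Prop :=
  forall A, is_iso (a A).

Definition naturally_isomorphic C D (F G : functor C D) : Prop :=
  exists a : nattrans F G, is_natiso a.

Section FunctorCategory.
Variables (C D : category).

Lemma nt_id_subproof (F : functor C D) A B (f : hom A B) :
  cmp (idm (F B)) (fmap F f) = cmp (fmap F f) (idm (F A)).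
Proof. by rewrite cmp_idl cmp_idr. Qed.
Definition nt_id F := NatTrans (@nt_id_subproof F).

Lemma nt_cmp_subproof (F G H : functor C D) (b : nattrans G H)
    (a : nattrans F G) A B (f : hom A B) :
  cmp (cmp (b B) (a B)) (fmap F f) = cmp (fmap H f) (cmp (b A) (a A)).
Proof. by rewrite -cmpA ntmapP cmpA ntmapP cmpA. Qed.
Definition nt_cmp F G H (b : nattrans G H) (a : nattrans F G) : nattrans F H :=
  NatTrans (nt_cmp_subproof b a).

Definition functor_category : category.
refine (@Category (functor C D) (@nattrans C D) nt_id nt_cmp _ _ _).
- by move=> F G a; apply: nattrans_ext => A /=; rewrite cmp_idl.
- by move=> F G a; apply: nattrans_ext => A /=; rewrite cmp_idr.
- by move=> F G H K c b a; apply: nattrans_ext => A /=; rewrite cmpA.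
Defined.
End FunctorCategory.

(** [postcomp I F] applies [F] pointwise to [I]-indexed diagrams. *)
Section Postcomp.
Variables (I C D : category) (F : functor C D).

Lemma postcomp_nt_subproof (X Y : functor I C) (a : nattrans X Y) i j
    (u : hom i j) :
  cmp (fmap F (a j)) (fmap (F \O X) u) = cmp (fmap (F \O Y) u) (fmap F (a i)).
Proof. by rewrite /= -!(functor_cmp (fmapP F)) ntmapP. Qed.
Definition postcomp_nt X Y (a : nattrans X Y) : nattrans (F \O X) (F \O Y) :=
  @NatTrans I D (F \O X) (F \O Y) (fun i => fmap F (a i))
    (postcomp_nt_subproof a).

Lemma postcomp_subproof :
  @is_functor (functor_category I C) (functor_category I D)
    (fun X => F \O X) postcomp_nt.
Proof.
split=> [X|X Y Z b a]; apply: nattrans_ext => i /=.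
  exact: (functor_id (fmapP F)).
exact: (functor_cmp (fmapP F)).
Qed.
Definition postcomp : functor (functor_category I C) (functor_category I D) :=
  Functor postcomp_subproof.
End Postcomp.

Definition opposite (C : category) : category :=
  @Category C (fun A B => hom B A) (fun A => idm A)
    (fun _ _ _ g f => cmp f g)
    (fun _ _ f => cmp_idr f) (fun _ _ f => cmp_idl f)
    (fun _ _ _ _ h g f => esym (cmpA f g h)).

(** [F] is left adjoint to [G], by unit, counit and the triangle identities. *)
Definition left_adjoint (C D : category) (F : functor C D) (G : functor D C) :
    Prop :=
  exists (eta : nattrans (id_functor C) (G \O F))
         (eps : nattrans (F \O G) (id_functor D)),
    (forall A, cmp (eps (F A)) (fmap F (eta A)) = idm (F A)) /\
    (forall B, cmp (fmap G (eps B)) (eta (G B)) = idm (G B)).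

Definition full_subcategory (C : category) (P : C -> Prop) : category :=
  @Category {A : C | P A} (fun A B => hom (sval A) (sval B))
    (fun A => idm (sval A)) (fun _ _ _ g f => cmp g f)
    (fun _ _ f => cmp_idl f) (fun _ _ f => cmp_idr f)
    (fun _ _ _ _ h g f => cmpA h g f).

Definition Sets : category :=
  @Category Type (fun A B => A -> B) (fun A => id) (fun _ _ _ g f => g \o f)
    (fun _ _ _ => erefl) (fun _ _ _ => erefl) (fun _ _ _ _ _ _ _ => erefl).

Section Ab.

Lemma additive_ext (U V : zmodType) (f g : {additive U -> V}) :
  f =1 g -> f = g.
Proof.
move=> /funext; case: f g => [f [[f1]]] [g [[g1]]] /= fg.
by case: _ / fg g1 => g1; do 3!congr (_ _); apply: Prop_irrelevance.
Qed.

Definition Ab : category.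
refine (@Category zmodType (fun U V => {additive U -> V})
  (fun U => idfun : {additive U -> U})
  (fun U V W (g : {additive V -> W}) (f : {additive U -> V}) =>
     (g \o f : {additive U -> W})) _ _ _); by move=> *; apply: additive_ext.
Defined.

End Ab.

Record metric (R : realType) := Metric {
  mcar :> Type;
  dist : mcar -> mcar -> \bar R;
  dist_ge0 : forall x y, (0 <= dist x y)%E;
  distxx : forall x, dist x x = 0%E;
  dist_sym : forall x y, dist x y = dist y x;
  dist_tri : forall x y z, (dist x z <= dist x y + dist y z)%E;
  dist_sep : forall x y, dist x y = 0%E -> x = y }.

Record nonexpansive (R : realType) (X Y : metric R) := Nonexpansive {
  nefun :> X -> Y;
  nefunP : forall x y, (dist (nefun x) (nefun y) <= dist x y)%E }.

Section Met.
Variable R : realType.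

Lemma nonexpansive_ext (X Y : metric R) (f g : nonexpansive X Y) :
  f =1 g -> f = g.
Proof.
case: f g => [f fP] [g gP] /= /funext fg.
by rewrite -fg in gP *; congr Nonexpansive; apply: Prop_irrelevance.
Qed.

Lemma ne_id_subproof (X : metric R) (x y : X) : (dist x y <= dist x y)%E.
Proof. exact: lexx. Qed.
Definition ne_id X := Nonexpansive (@ne_id_subproof X).

Lemma ne_cmp_subproof (X Y Z : metric R) (g : nonexpansive Y Z)
    (f : nonexpansive X Y) x y :
  (dist (g (f x)) (g (f y)) <= dist x y)%E.
Proof. exact: le_trans (nefunP _ _ _) (nefunP _ _ _). Qed.
Definition ne_cmp X Y Z g f := Nonexpansive (@ne_cmp_subproof X Y Z g f).

Definition Met : category.
refine (@Category (metric R) (@nonexpansive R) ne_id ne_cmp _ _ _);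
  by move=> *; apply: nonexpansive_ext.
Defined.
End Met.

Record signature := Signature { ops :> finType; ar : ops -> nat }.

Inductive term (Om : signature) (V : Type) :=
| Var of V
| App (f : Om) of ('I_(ar f) -> term Om V).
Arguments Var {_ _} _.
Arguments App {_ _} _ _.

(** The unique extension of [i] to a homomorphism. *)
Fixpoint eval (Om : signature) (V A : Type)
    (opA : forall f : Om, ('I_(ar f) -> A) -> A) (i : V -> A)
    (t : term Om V) : A :=
  match t with
  | Var x => i x
  | App f ts => opA f (fun k => eval opA i (ts k))
  end.

Section Theories.
Variable Om : signature.

(** The fixed countably infinite set of variables is [nat]. *)
Local Notation tm := (term Om nat).

Record qeq := QEq { lhs : tm; tol : {nonneg rat}; rhs : tm }.
Local Notation "t =[ e ] s" := (QEq t e s)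
  (at level 70, e at next level, no associativity).

Definition subst (s : nat -> tm) : tm -> tm := eval (@App Om nat) s.
Definition subst_qeq (s : nat -> tm) (p : qeq) : qeq :=
  subst s (lhs p) =[tol p] subst s (rhs p).

Record deducibility (D : set qeq -> qeq -> Prop) : Prop := Deducibility {
  ded_refl : forall t, D set0 (t =[0%:nng] t);
  ded_sym : forall t s e, D [set t =[e] s] (s =[e] t);
  ded_tri : forall t s u e e',
    D [set t =[e] s; s =[e'] u] (t =[(e%:num + e'%:num)%:nng] u);
  ded_max : forall t s (e e' : {nonneg rat}), 0 < e'%:num ->
    D [set t =[e] s] (t =[(e%:num + e'%:num)%:nng] s);
  ded_arch : forall t s (e : {nonneg rat}),
    D [set t =[e'] s | e' in [set e' : {nonneg rat} | e%:num < e'%:num]]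
      (t =[e] s);
  ded_ne : forall (f : Om) (ts ss : 'I_(ar f) -> tm) e,
    D [set ts i =[e] ss i | i in [set: 'I_(ar f)]] (App f ts =[e] App f ss);
  ded_subst : forall (s : nat -> tm) G p,
    D G p -> D (subst_qeq s @` G) (subst_qeq s p);
  ded_cut : forall G G' p, (forall q, G' q -> D G q) -> D G' p -> D G p;
  ded_hyp : forall (G : set qeq) p, G p -> D G p }.

(** Inferences are pairs [(G, p)] with [finite_set G]; the finiteness condition
    is carried by the sets of inferences below. *)
Definition inference : Type := (set qeq * qeq)%type.

Definition basic (I : inference) : Prop :=
  forall p, I.1 p -> exists x y : nat, lhs p = Var x /\ rhs p = Var y.

Definition least_deducibility (S : set inference) (G : set qeq) (p : qeq) :=
  forall D, deducibility D -> (forall I, S I -> D I.1 I.2) -> D G p.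

Definition induced_theory (S : set inference) : set inference :=
  [set I | finite_set I.1 /\ least_deducibility S I.1 I.2].

Definition quantitative_theory (U : set inference) : Prop :=
  exists2 S : set inference,
    (forall I, S I -> finite_set I.1 /\ basic I) & U = induced_theory S.

End Theories.

Record qalgebra (R : realType) (Om : signature) := QAlgebra {
  qcar :> metric R;
  qop : forall f : Om, ('I_(ar f) -> qcar) -> qcar;
  qopP : forall (f : Om) (a b : 'I_(ar f) -> qcar) (e : {nonneg R}),
    (forall i, (dist (a i) (b i) <= e%:num%:E)%E) ->
    (dist (qop a) (qop b) <= e%:num%:E)%E }.
Arguments qop {R Om} q f _.

Record qhom (R : realType) (Om : signature) (A B : qalgebra R Om) := QHom {
  qfun :> nonexpansive A B;
  qfunP : forall (f : Om) (a : 'I_(ar f) -> A),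
    qfun (qop A f a) = qop B f (fun i => qfun (a i)) }.

Section Models.
Variables (R : realType) (Om : signature).

Lemma qhom_ext (A B : qalgebra R Om) (f g : qhom A B) : f =1 g -> f = g.
Proof.
case: f g => [f fP] [g gP] /= /nonexpansive_ext fg.
by rewrite -fg in gP *; congr QHom; apply: Prop_irrelevance.
Qed.

Lemma qhom_id_subproof (A : qalgebra R Om) (f : Om) (a : 'I_(ar f) -> A) :
  qop A f a = qop A f (fun i => a i).
Proof. by []. Qed.
Definition qhom_id A := @QHom R Om A A (ne_id A) (@qhom_id_subproof A).

Lemma qhom_cmp_subproof (A B C : qalgebra R Om) (h : qhom B C) (g : qhom A B)
    (f : Om) (a : 'I_(ar f) -> A) :
  ne_cmp h g (qop A f a) = qop C f (fun i => ne_cmp h g (a i)).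
Proof. by rewrite /= !qfunP. Qed.
Definition qhom_cmp A B C (h : qhom B C) (g : qhom A B) :=
  QHom (@qhom_cmp_subproof A B C h g).

Definition QAlg : category.
refine (@Category (qalgebra R Om) (@qhom R Om) qhom_id qhom_cmp _ _ _);
  by move=> *; apply: qhom_ext.
Defined.

Definition holds (A : qalgebra R Om) (i : nat -> A) (p : qeq Om) : Prop :=
  (dist (eval (qop A) i (lhs p)) (eval (qop A) i (rhs p))
     <= (ratr (tol p)%:num)%:E)%E.

Definition satisfies (A : qalgebra R Om) (I : inference Om) : Prop :=
  forall i : nat -> A, (forall p, I.1 p -> holds i p) -> holds i I.2.

Definition Mod (U : set (inference Om)) : category :=
  @full_subcategory QAlg (fun A => forall I, U I -> satisfies A I).

Lemma forget_subproof (U : set (inference Om)) :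
  @is_functor (Mod U) (Met R) (fun A => qcar (sval A)) (fun A B f => qfun f).
Proof. by split=> *; apply: nonexpansive_ext. Qed.
Definition forget U : functor (Mod U) (Met R) := Functor (forget_subproof U).

End Models.

(** Existence of the left adjoint of [forget U]: the terms over a metric space
    [X], with the largest distance seen by nonexpansive maps from [X] into
    models of [U], modulo distance zero. *)
Section FreeModel.
Variables (R : realType) (Om : signature) (U : set (inference Om)).
Variable X : metric R.

Local Notation tmX := (term Om X).
Local Notation model := (obj (Mod R U)).

Definition tdists (t s : tmX) : set (\bar R) :=
  [set r | r = 0%E \/ exists (B : model) (f : nonexpansive X (qcar (sval B))),
    r = dist (eval (qop (sval B)) f t) (eval (qop (sval B)) f s)].

Definition tdist (t s : tmX) : \bar R := ereal_sup (tdists t s).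

Lemma tdist_le t s (e : \bar R) : (0 <= e)%E ->
  (forall (B : model) (f : nonexpansive X (qcar (sval B))),
    (dist (eval (qop (sval B)) f t) (eval (qop (sval B)) f s) <= e)%E) ->
  (tdist t s <= e)%E.
Proof.
by move=> e0 H; apply: ge_ereal_sup => r /= [->//|[B [f ->]]]; apply: H.
Qed.

Lemma le_tdist t s (B : model) (f : nonexpansive X (qcar (sval B))) :
  (dist (eval (qop (sval B)) f t) (eval (qop (sval B)) f s) <= tdist t s)%E.
Proof. by apply: ereal_sup_ubound => /=; right; exists B, f. Qed.

Lemma tdist_ge0 t s : (0 <= tdist t s)%E.
Proof. by apply: ereal_sup_ubound; left. Qed.

Lemma tdistxx t : tdist t t = 0%E.
Proof.
apply/eqP; rewrite eq_le tdist_ge0 andbT; apply: tdist_le => // B f.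
by rewrite distxx.
Qed.

Lemma tdist_symle t s : (tdist t s <= tdist s t)%E.
Proof.
by apply: tdist_le => [|B f]; rewrite ?tdist_ge0// dist_sym le_tdist.
Qed.

Lemma tdist_sym t s : tdist t s = tdist s t.
Proof. by apply/eqP; rewrite eq_le !tdist_symle. Qed.

Lemma tdist_tri t s u : (tdist t u <= tdist t s + tdist s u)%E.
Proof.
apply: tdist_le => [|B f]; first by rewrite adde_ge0 ?tdist_ge0.
by apply: le_trans (dist_tri _ _ _) _; apply: leeD; apply: le_tdist.
Qed.

Definition teq (t s : {classic tmX}) : bool := `[< tdist t s = 0%E >].

Lemma teq_equiv : equiv_class_of teq.
Proof.
split=> [t|t s|s t u].
- by apply/asboolP; rewrite tdistxx.
- by rewrite /teq tdist_sym.
- move=> /asboolP ts /asboolP su; apply/asboolP/eqP.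
  by rewrite eq_le tdist_ge0 andbT (le_trans (tdist_tri t s u))// ts su adde0.
Qed.

Canonical teq_equivrel := EquivRelPack teq_equiv.

Definition free_car : Type := {eq_quot teq}.
Definition fcls (t : tmX) : free_car := \pi_({eq_quot teq}) (t : {classic tmX}).
Definition frep (a : free_car) : tmX := repr (a : {eq_quot teq}).

Lemma fcls_eq t s : tdist t s = 0%E -> fcls t = fcls s.
Proof. by move=> ts; apply/eqmodP/asboolP. Qed.

Lemma frepK a : fcls (frep a) = a.
Proof. exact: reprK. Qed.

Lemma frep_cls t : tdist (frep (fcls t)) t = 0%E.
Proof. by apply/asboolP; rewrite -[`[< _ >]]/(teq _ _); apply/eqmodP; apply: reprK. Qed.

Definition free_dist (a b : free_car) := tdist (frep a) (frep b).

Lemma free_dist_cls t s : free_dist (fcls t) (fcls s) = tdist t s.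
Proof.
have le t' s' t'' s'' : tdist t' t'' = 0%E -> tdist s' s'' = 0%E ->
    (tdist t' s' <= tdist t'' s'')%E.
  move=> tt ss; apply: le_trans (tdist_tri _ t'' _) _; rewrite tt add0e.
  by apply: le_trans (tdist_tri _ s'' _) _; rewrite [tdist s'' _]tdist_sym ss adde0.
apply/eqP; rewrite eq_le !le//;
  by [exact: frep_cls | rewrite tdist_sym; exact: frep_cls].
Qed.

Lemma free_dist_sep a b : free_dist a b = 0%E -> a = b.
Proof. by move=> /fcls_eq; rewrite !frepK. Qed.

Definition free_metric : metric R :=
  @Metric R free_car free_dist (fun _ _ => tdist_ge0 _ _) (fun _ => tdistxx _)
    (fun _ _ => tdist_sym _ _) (fun _ _ _ => tdist_tri _ _ _) free_dist_sep.

Definition free_op (f : Om) (a : 'I_(ar f) -> free_metric) : free_metric :=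
  fcls (App f (fun i => frep (a i))).

Lemma free_opP (f : Om) (a b : 'I_(ar f) -> free_metric) (e : {nonneg R}) :
    (forall i, (dist (a i) (b i) <= e%:num%:E)%E) ->
  (dist (free_op a) (free_op b) <= e%:num%:E)%E.
Proof.
move=> ab; rewrite /= free_dist_cls; apply: tdist_le => [|B g /=].
  by rewrite lee_fin.
by apply: qopP => i; apply: le_trans (ab i); apply: le_tdist.
Qed.

Definition free_alg : qalgebra R Om := QAlgebra free_opP.

Definition free_evalm (B : model) (g : nonexpansive X (qcar (sval B)))
  (a : free_alg) : sval B := eval (qop (sval B)) g (frep a).

Lemma free_evalm_cls (B : model) (g : nonexpansive X (qcar (sval B))) t :
  free_evalm g (fcls t) = eval (qop (sval B)) g t.
Proof.
apply: dist_sep; apply/eqP; rewrite eq_le dist_ge0 andbT.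
by rewrite -(frep_cls t) le_tdist.
Qed.

Lemma free_evalm_eval (B : model) (g : nonexpansive X (qcar (sval B)))
    (i : nat -> free_alg) t :
  free_evalm g (eval (qop free_alg) i t) =
  eval (qop (sval B)) (fun x => free_evalm g (i x)) t.
Proof.
elim: t => [//|f ts IH] /=; rewrite /free_op free_evalm_cls /=.
by congr (qop _ _ _); apply: functional_extensionality_dep => k; apply: IH.
Qed.

Lemma free_distE (a b : free_alg) (e : \bar R) : (0 <= e)%E ->
  (forall (B : model) (g : nonexpansive X (qcar (sval B))),
    (dist (free_evalm g a) (free_evalm g b) <= e)%E) ->
  (dist a b <= e)%E.
Proof. exact: tdist_le. Qed.

Lemma free_algP I : U I -> satisfies free_alg I.
Proof.
move=> UI i iG; apply: free_distE => [|B g].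
  by rewrite lee_fin ler0q.
rewrite !free_evalm_eval; apply: (svalP B I UI) => p /iG ip.
by rewrite /holds -!free_evalm_eval; apply: le_trans ip; apply: le_tdist.
Qed.

Definition free_model : Mod R U := exist _ free_alg free_algP.

Lemma free_unit_subproof (x y : X) :
  (dist (fcls (Var x) : free_alg) (fcls (Var y) : free_alg) <= dist x y)%E.
Proof.
by rewrite /= free_dist_cls; apply: tdist_le => [|B f]; rewrite ?dist_ge0 ?nefunP.
Qed.
Definition free_unit : nonexpansive X free_alg :=
  Nonexpansive free_unit_subproof.

Lemma free_ext_ne (B : model) (g : nonexpansive X (qcar (sval B)))
    (a b : free_alg) :
  (dist (free_evalm g a) (free_evalm g b) <= dist a b)%E.
Proof. exact: le_tdist. Qed.

Lemma free_ext_hom (B : model) (g : nonexpansive X (qcar (sval B)))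
    (f : Om) (a : 'I_(ar f) -> free_alg) :
  Nonexpansive (free_ext_ne g) (qop free_alg f a) =
  qop (sval B) f (fun i => Nonexpansive (free_ext_ne g) (a i)).
Proof. by rewrite /= /free_op free_evalm_cls. Qed.

Definition free_ext (B : model) (g : nonexpansive X (qcar (sval B))) :
  qhom free_alg (sval B) := QHom (free_ext_hom g).

Lemma free_ext_unit (B : model) (g : nonexpansive X (qcar (sval B))) :
  ne_cmp (free_ext g) free_unit = g.
Proof. by apply: nonexpansive_ext => x /=; rewrite free_evalm_cls. Qed.

Lemma free_ext_uniq (B : model) (h k : qhom free_alg (sval B)) :
  ne_cmp h free_unit = ne_cmp k free_unit -> h = k.
Proof.
move=> hk; apply: qhom_ext => a; rewrite -(frepK a).
elim: (frep a) => [x|f ts IH].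
  exact: (congr1 (fun u : nonexpansive _ _ => u x) hk).
have -> : fcls (App f ts) = qop free_alg f (fun i => fcls (ts i)).
  rewrite /= /free_op; apply: fcls_eq; apply/eqP.
  rewrite eq_le tdist_ge0 andbT; apply: tdist_le => // B' g /=.
  apply: (@qopP _ _ _ f _ _ 0%:nng) => i.
  by apply: le_trans (le_tdist _ _ _) _; rewrite tdist_sym frep_cls.
rewrite !qfunP; congr (qop _ _ _); exact: functional_extensionality_dep.
Qed.

End FreeModel.

Lemma universal_left_adjoint (C D : category) (G : functor D C) (F0 : C -> D)
    (eta : forall A, hom A (G (F0 A)))
    (ext : forall A B, hom A (G B) -> hom (F0 A) B) :
    (forall A B (f : hom A (G B)), cmp (fmap G (ext A B f)) (eta A) = f) ->
    (forall A B (h k : hom (F0 A) B),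
       cmp (fmap G h) (eta A) = cmp (fmap G k) (eta A) -> h = k) ->
  exists F : functor C D, left_adjoint F G.
Proof.
move=> extE extU.
pose F1 A B (f : hom A B) : hom (F0 A) (F0 B) := ext _ _ (cmp (eta B) f).
have F1P : is_functor F1.
  split=> [A|A B E g f]; apply: extU; rewrite /F1 extE.
    by rewrite cmp_idr (functor_id (fmapP G)) cmp_idl.
  by rewrite (functor_cmp (fmapP G)) -[RHS]cmpA extE [RHS]cmpA extE -cmpA.
exists (Functor F1P).
have etaP A B (f : hom A B) : cmp (eta B) f = cmp (fmap G (F1 _ _ f)) (eta A).
  by rewrite /F1 extE.
have epsP A B (f : hom A B) :
    cmp (ext _ B (idm (G B))) (F1 _ _ (fmap G f)) =
    cmp f (ext _ A (idm (G A))).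
  apply: extU; rewrite /F1 !(functor_cmp (fmapP G)) -!cmpA !extE cmpA extE.
  by rewrite cmp_idl cmp_idr.
exists (@NatTrans C C (id_functor C) (G \O Functor F1P) eta etaP).
exists (@NatTrans D D (Functor F1P \O G) (id_functor D) _ epsP).
split=> [A|B] /=; last exact: extE.
apply: extU; rewrite /F1 (functor_cmp (fmapP G)) -cmpA extE cmpA extE cmp_idl.
by rewrite (functor_id (fmapP G)) cmp_idl.
Qed.

Lemma forget_has_left_adjoint (R : realType) (Om : signature)
    (U : set (inference Om)) :
  exists Free : functor (Met R) (Mod R U), left_adjoint Free (forget R U).
Proof.
apply: (@universal_left_adjoint (Met R) (Mod R U) (forget R U)
  (free_model U) (free_unit U) (fun X B => @free_ext R Om U X B)) => A B.
- exact: free_ext_unit.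
- exact: free_ext_uniq.
Qed.

Record subgroup (V : zmodType) := Subgroup {
  sgset :> V -> Prop;
  sg0 : sgset 0;
  sgB : forall x y, sgset x -> sgset y -> sgset (x - y) }.

Section Subgroups.
Variable V : zmodType.
Implicit Types S T : subgroup V.

Definition sgpred S : V -> bool := fun x => `[< S x >].

Lemma sgpred_closed S : zmod_closed (sgpred S).
Proof.
split; first exact/asboolP/sg0.
by move=> x y /asboolP Sx /asboolP Sy; apply/asboolP/sgB.
Qed.
HB.instance Definition _ S :=
  GRing.isZmodClosed.Build V (sgpred S) (sgpred_closed S).

Definition sub S : Type := {x : V | sgpred S x}.
HB.instance Definition _ S := [isSub of sub S for @sval _ _].
HB.instance Definition _ S := [Choice of sub S by <:].
HB.instance Definition _ S := [SubChoice_isSubZmodule of sub S by <:].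

Definition sgclosed S : zmodClosed V := GRing.ZmodClosed.clone V (sgpred S) _.
Local Notation sgquot S := {ideal_quot (sgclosed S)}.
Definition quotient S : zmodType := sgquot S.
Definition cls S (x : V) : quotient S := \pi_(sgquot S) x.

Lemma cls_additive S : zmod_morphism (cls S).
Proof. by move=> x y; rewrite /cls raddfB. Qed.
HB.instance Definition _ S :=
  GRing.isZmodMorphism.Build V (quotient S) (cls S) (cls_additive S).

Lemma clsP S x y : cls S x = cls S y <-> S (x - y).
Proof.
rewrite /cls; split=> [/eqP|xy]; last apply/eqP.
  by rewrite -Quotient.idealrBE => /asboolP.
by rewrite -Quotient.idealrBE; apply/asboolP.
Qed.

Lemma cls_surj S (a : quotient S) : exists x, a = cls S x.
Proof. by exists (repr (a : (sgquot S))); rewrite /cls reprK. Qed.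

Lemma subE S (a : sub S) : S (val a).
Proof. exact/asboolP/(valP a). Qed.

Definition insub_sg S x (h : S x) : sub S := exist _ x (asboolT h).

Lemma sgN S x : S x -> S (- x).
Proof. by move=> Sx; rewrite -sub0r; apply: sgB => //; apply: sg0. Qed.

Lemma sgD S x y : S x -> S y -> S (x + y).
Proof. by move=> Sx Sy; rewrite -(opprK y); apply: sgB => //; apply: sgN. Qed.

Lemma sg_sum S (I : Type) (r : seq I) (P : pred I) (F : I -> V) :
  (forall i, P i -> S (F i)) -> S (\sum_(i <- r | P i) F i).
Proof. by move=> H; elim/big_ind: _ => //; [apply: sg0 | apply: sgD]. Qed.

Lemma sgMz S x (k : int) : S x -> S (x *~ k).
Proof.
move=> Sx; have Sn n : S (x *+ n).
  elim: n => [|n IH]; first by rewrite mulr0n; apply: sg0.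
  by rewrite mulrS; apply: sgD.
by case: k => n; [apply: Sn | rewrite NegzE mulrNz; apply/sgN/Sn].
Qed.

End Subgroups.

Section Span.
Variables (V : zmodType) (P : set V).
Definition span_set : set V :=
  [set x | forall S : subgroup V, (forall y, P y -> S y) -> S x].
Lemma span_set0 : span_set 0. Proof. by move=> S _; apply: sg0. Qed.
Lemma span_setB x y : span_set x -> span_set y -> span_set (x - y).
Proof. by move=> Px Py S PS; apply: sgB; [apply: Px | apply: Py]. Qed.
Definition span : subgroup V := Subgroup span_set0 span_setB.
Lemma span_gen x : P x -> span x. Proof. by move=> Px S; apply. Qed.
End Span.

Section ImPreim.
Variables (U V : zmodType) (f : {additive U -> V}).

Lemma preim0 (S : subgroup V) : S (f 0).
Proof. by rewrite raddf0; apply: sg0. Qed.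
Lemma preimB (S : subgroup V) x y : S (f x) -> S (f y) -> S (f (x - y)).
Proof. by rewrite raddfB; apply: sgB. Qed.
Definition preim_sg (S : subgroup V) : subgroup U :=
  @Subgroup U [set x | S (f x)] (@preim0 S) (@preimB S).

Lemma im0 : exists x, 0 = f x. Proof. by exists 0; rewrite raddf0. Qed.
Lemma imB y z : (exists x, y = f x) -> (exists x, z = f x) ->
  exists x, y - z = f x.
Proof. by move=> [x ->] [x' ->]; exists (x - x'); rewrite raddfB. Qed.
Definition im_sg : subgroup V := @Subgroup V [set y | exists x, y = f x] im0 imB.

Lemma ker0 : f 0 = 0. Proof. exact: raddf0. Qed.
Lemma kerB x y : f x = 0 -> f y = 0 -> f (x - y) = 0.
Proof. by rewrite raddfB => -> ->; rewrite subr0. Qed.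
Definition ker_sg : subgroup U := @Subgroup U [set x | f x = 0] ker0 kerB.

Lemma span_map (P : set U) (S : subgroup V) :
  (forall x, P x -> S (f x)) -> forall x, span P x -> S (f x).
Proof. by move=> PS x /(_ (preim_sg S)); apply. Qed.

Section QuotMap.
Variables (S : subgroup U) (T : subgroup V) (h : forall x, S x -> T (f x)).

Definition quot_map_fun (a : quotient S) : quotient T := cls T (f (repr a)).

Lemma quot_map_funE x : quot_map_fun (cls S x) = cls T (f x).
Proof.
apply/clsP; rewrite -raddfB; apply: h; apply/clsP.
by rewrite /cls reprK.
Qed.

Lemma quot_map_additive : zmod_morphism quot_map_fun.
Proof.
move=> a b; have [x ->] := cls_surj a; have [y ->] := cls_surj b.
by rewrite -raddfB !quot_map_funE !raddfB.
Qed.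
HB.instance Definition _ := GRing.isZmodMorphism.Build
  (quotient S) (quotient T) quot_map_fun quot_map_additive.

Definition quot_map : {additive quotient S -> quotient T} := quot_map_fun.

Lemma quot_mapE x : quot_map (cls S x) = cls T (f x).
Proof. exact: quot_map_funE. Qed.

Definition sub_map_fun (a : sub S) : sub T := insub_sg (h (subE a)).

Lemma sub_map_additive : zmod_morphism sub_map_fun.
Proof. by move=> a b; apply: val_inj; rewrite /= raddfB. Qed.
HB.instance Definition _ := GRing.isZmodMorphism.Build
  (sub S) (sub T) sub_map_fun sub_map_additive.

Definition sub_map : {additive sub S -> sub T} := sub_map_fun.

Lemma sub_mapE a : val (sub_map a) = f (val a).
Proof. by []. Qed.

End QuotMap.

Section Corestrict.
Variables (T : subgroup V) (h : forall x, T (f x)).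
Definition cores_fun (x : U) : sub T := insub_sg (h x).
Lemma cores_additive : zmod_morphism cores_fun.
Proof. by move=> a b; apply: val_inj; rewrite /= raddfB. Qed.
HB.instance Definition _ := GRing.isZmodMorphism.Build
  U (sub T) cores_fun cores_additive.
Definition cores : {additive U -> sub T} := cores_fun.
End Corestrict.

End ImPreim.

Definition sub_incl (V : zmodType) (S : subgroup V) : {additive sub S -> V} :=
  val.

Record complex := Complex {
  cgrp :> nat -> zmodType;
  cdiff : forall n, {additive cgrp n.+1 -> cgrp n};
  cdiffK : forall n x, cdiff n (cdiff n.+1 x) = 0 }.
Arguments cdiff _ {_}.

Record chain_map (C D : complex) := ChainMap {
  cmap :> forall n, {additive C n -> D n};
  cmapP : forall n x, cmap n (cdiff C x) = cdiff D (cmap n.+1 x) }.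

Lemma chain_map_ext (C D : complex) (f g : chain_map C D) :
  (forall n, f n =1 g n) -> f = g.
Proof.
case: f g => [f fP] [g gP] /= fg.
have {}fg : f = g.
  by apply: functional_extensionality_dep => n; apply: additive_ext; apply: fg.
by rewrite -fg in gP *; congr ChainMap; apply: Prop_irrelevance.
Qed.

Lemma chain_id_subproof (C : complex) n (x : C n.+1) :
  (idfun : {additive C n -> C n}) (cdiff C x) =
  cdiff C ((idfun : {additive C n.+1 -> C n.+1}) x).
Proof. by []. Qed.
Definition chain_id C :=
  @ChainMap C C (fun n => idfun : {additive C n -> C n}) (@chain_id_subproof C).

Lemma chain_cmp_subproof (C D E : complex) (g : chain_map D E)
    (f : chain_map C D) n (x : C n.+1) :
  (g n \o f n) (cdiff C x) = cdiff E ((g n.+1 \o f n.+1) x).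
Proof. by rewrite /= !cmapP. Qed.
Definition chain_cmp C D E (g : chain_map D E) (f : chain_map C D) :=
  @ChainMap C E (fun n => g n \o f n : {additive C n -> E n})
    (chain_cmp_subproof g f).

Definition Ch : category.
refine (@Category complex chain_map chain_id chain_cmp _ _ _);
  by move=> *; apply: chain_map_ext.
Defined.

Section Homology.

Definition cycles (C : complex) n : subgroup (C n) :=
  match n with
  | 0 => ker_sg (\0 : {additive C 0 -> C 0})
  | m.+1 => ker_sg (@cdiff C m)
  end.

Definition boundaries (C : complex) n : subgroup (sub (cycles C n)) :=
  preim_sg (sub_incl (cycles C n)) (im_sg (@cdiff C n)).

Definition homology n (C : complex) : zmodType := quotient (boundaries C n).

Lemma cycles_map (C D : complex) (f : chain_map C D) n x :
  cycles C n x -> cycles D n (f n x).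
Proof. by case: n x => [|n] x //= fx; rewrite -cmapP fx raddf0. Qed.

Definition cycles_mor (C D : complex) (f : chain_map C D) n :
    {additive sub (cycles C n) -> sub (cycles D n)} :=
  sub_map (@cycles_map C D f n).

Lemma boundaries_map (C D : complex) (f : chain_map C D) n x :
  boundaries C n x -> boundaries D n (cycles_mor f n x).
Proof. by move=> [y /= xy]; exists (f n.+1 y) => /=; rewrite [X in f n X]xy cmapP. Qed.

Definition homology_map n (C D : complex) (f : chain_map C D) :
    {additive homology n C -> homology n D} :=
  quot_map (@boundaries_map C D f n).

Lemma homology_mapE n (C D : complex) (f : chain_map C D) x :
  homology_map n f (cls _ x) = cls _ (cycles_mor f n x).
Proof. exact: (quot_mapE (@boundaries_map C D f n)). Qed.

Lemma homology_subproof n : @is_functor Ch Ab (homology n) (@homology_map n).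
Proof.
split=> [C|C D E g f]; apply: additive_ext => a; have [x ->] := cls_surj a.
  by rewrite homology_mapE; apply: (congr1 (cls _)); apply: val_inj.
rewrite [RHS](_ : _ = homology_map n g (homology_map n f (cls _ x))) //.
by rewrite !homology_mapE; apply: (congr1 (cls _)); apply: val_inj.
Qed.
Definition Hn n : functor Ch Ab := Functor (homology_subproof n).

End Homology.

Record monotone (m n : nat) := Monotone {
  mfun :> 'I_m.+1 -> 'I_n.+1;
  mfunP : forall i j : 'I_m.+1, (i <= j)%N -> (mfun i <= mfun j)%N }.

Lemma monotone_ext m n (f g : monotone m n) :
  (forall i, f i = g i :> nat) -> f = g.
Proof.
case: f g => [f fP] [g gP] /= fg.
have {}fg : f = g.
  by apply: functional_extensionality_dep => i; apply: val_inj; apply: fg.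
by rewrite -fg in gP *; congr Monotone; apply: Prop_irrelevance.
Qed.

Lemma monotone_id_subproof n (i j : 'I_n.+1) : (i <= j)%N -> (i <= j)%N.
Proof. by []. Qed.
Definition monotone_id n := @Monotone n n id (@monotone_id_subproof n).

Lemma monotone_cmp_subproof m n p (g : monotone n p) (f : monotone m n)
    (i j : 'I_m.+1) : (i <= j)%N -> ((g \o f) i <= (g \o f) j)%N.
Proof. by move=> ij; do 2!apply: mfunP. Qed.
Definition monotone_cmp m n p (g : monotone n p) (f : monotone m n) :=
  @Monotone m p (g \o f) (monotone_cmp_subproof g f).

(** The simplex category; the object [n] is the ordinal {0 < ... < n}. *)
Definition Delta : category.
refine (@Category nat monotone monotone_id monotone_cmp _ _ _);
  by move=> *; apply: monotone_ext.
Defined.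

Definition sSet : category := functor_category (opposite Delta) Sets.

Lemma coface_subproof n (i : 'I_n.+2) (j k : 'I_n.+1) :
  (j <= k)%N -> (fintype.lift i j <= fintype.lift i k)%N.
Proof. by rewrite leq_bump2. Qed.
Definition coface n (i : 'I_n.+2) : monotone n n.+1 :=
  @Monotone n n.+1 (fintype.lift i) (@coface_subproof n i).

Lemma codeg_ltn n (i : 'I_n.+1) (j : 'I_n.+2) : (unbump i j < n.+1)%N.
Proof. by rewrite /unbump; have := ltn_ord i; have := ltn_ord j; lia. Qed.

Lemma codeg_subproof n (i : 'I_n.+1) (j k : 'I_n.+2) : (j <= k)%N ->
  (Ordinal (codeg_ltn i j) <= Ordinal (codeg_ltn i k))%N.
Proof. by rewrite /= /unbump; lia. Qed.
Definition codeg n (i : 'I_n.+1) : monotone n.+1 n :=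
  @Monotone n.+1 n _ (@codeg_subproof n i).

Section Chains.
Variable X : sSet.

Definition smp (n : nat) : Type := fobj X n.

Definition face n (i : 'I_n.+2) (x : smp n.+1) : smp n :=
  @fmap _ _ X n.+1 n (coface i) x.
Definition degen n (i : 'I_n.+1) (x : smp n) : smp n.+1 :=
  @fmap _ _ X n n.+1 (codeg i) x.

Definition degenerate n : set (smp n) :=
  match n with
  | 0 => fun _ => False
  | m.+1 => fun x => exists (i : 'I_m.+1) (y : smp m), x = degen i y
  end.

Lemma smp_cmp m n p (f : monotone m n) (g : monotone n p) (x : smp p) :
  @fmap _ _ X n m f (@fmap _ _ X p n g x) =
  @fmap _ _ X p m (monotone_cmp g f) x.
Proof.
by have := functor_cmp (fmapP X) (f : @hom (opposite Delta) n m)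
  (g : @hom (opposite Delta) p n) => /(congr1 (fun h => h x)) /= ->.
Qed.

Lemma smp_id n (x : smp n) : @fmap _ _ X n n (monotone_id n) x = x.
Proof.
exact: (congr1 (fun h => h x) (functor_id (fmapP X) (n : opposite Delta))).
Qed.

Lemma face_face n (i j : 'I_n.+2) (x : smp n.+2) : (i <= j)%N ->
  face i (face (fintype.lift ord0 j) x) = face j (face (widen_ord (leqnSn _) i) x).
Proof.
move=> ij; rewrite /face !smp_cmp; congr (fmap X _ _).
by apply: monotone_ext => k /=; rewrite /bump; lia.
Qed.

Lemma face_degen_id n (i : 'I_n.+1) (j : 'I_n.+2) (y : smp n) :
  (j == i :> nat) || (j == i.+1 :> nat) -> face j (degen i y) = y.
Proof.
move=> ji; rewrite /face /degen smp_cmp -[RHS]smp_id; congr (fmap X _ _).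
by apply: monotone_ext => k /=; rewrite /bump /unbump; lia.
Qed.

Lemma face_degen n (i : 'I_n.+1) (j : 'I_n.+2) (y : smp n) :
  (j != i :> nat) -> (j != i.+1 :> nat) -> degenerate (face j (degen i y)).
Proof.
case: n i j y => [|n] i j y /=.
  by case: i => -[|//] ? /=; case: j => -[|[|//]] ?.
move=> ji jSi; have := ltn_ord i; have := ltn_ord j => jlt ilt.
case: (ltnP j i) => ij.
  have h1 : (i.-1 < n.+1)%N by lia.
  have h2 : (j < n.+2)%N by lia.
  exists (Ordinal h1), (face (Ordinal h2) y).
  rewrite /face /degen !smp_cmp; congr (fmap X _ _).
  by apply: monotone_ext => k /=; rewrite /bump /unbump; lia.
have h1 : (i < n.+1)%N by lia.
have h2 : (j.-1 < n.+2)%N by lia.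
exists (Ordinal h1), (face (Ordinal h2) y).
rewrite /face /degen !smp_cmp; congr (fmap X _ _).
by apply: monotone_ext => k /=; rewrite /bump /unbump; lia.
Qed.

End Chains.

(** [{classic T}] only supplies the choice structure required by [freeg]. *)
Notation freeab T := {freeg {classic T} / int}.

Section FreeAb.

Definition gen (T : Type) (x : T) : freeab T := << (x : {classic T}) >>.

Lemma freeab_span (T : Type) (S : subgroup (freeab T)) :
  (forall x, S (gen x)) -> forall c, S c.
Proof.
move=> Sg c; rewrite -[c]freeg_sumE; apply: sg_sum => x _.
have -> : << coeff x c *g x >> = gen x *~ coeff x c :> freeab T.
  by rewrite /gen freegU_mulz intz.
exact: sgMz.
Qed.

Lemma freeab_ext (T : Type) (V : zmodType) (f g : {additive freeab T -> V}) :
  (forall x, f (gen x) = g (gen x)) -> f =1 g.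
Proof.
move=> fg c; apply/eqP; rewrite -subr_eq0; apply/eqP.
have E0 : f 0 - g 0 = 0 by rewrite (raddf0 f) (raddf0 g) subrr.
have EB x y : f x - g x = 0 -> f y - g y = 0 -> f (x - y) - g (x - y) = 0.
  by move=> /subr0_eq fx /subr0_eq fy; rewrite (raddfB f) (raddfB g) fx fy subrr.
by apply: (@freeab_span T (Subgroup E0 EB)) => x /=; rewrite fg subrr.
Qed.

Definition freelift (T T' : Type) (F : T -> freeab T') (c : freeab T) :
    freeab T' :=
  fglift (F : {classic T} -> freeab T') c.

Lemma freelift_additive (T T' : Type) (F : T -> freeab T') :
  zmod_morphism (freelift F).
Proof. exact: lift_is_additive. Qed.
HB.instance Definition _ T T' F := GRing.isZmodMorphism.Build
  (freeab T) (freeab T') (freelift F) (@freelift_additive T T' F).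

Lemma freelift_gen (T T' : Type) (F : T -> freeab T') x :
  freelift F (gen x) = F x.
Proof. by rewrite /freelift /gen liftU scale1r. Qed.

End FreeAb.

Section AlternatingSum.

Lemma alt_sum0 (V : zmodType) n (F : 'I_n.+1 -> 'I_n.+2 -> V) :
  (forall i j : 'I_n.+1, (i <= j)%N ->
     F i (fintype.lift ord0 j) = - F j (widen_ord (leqnSn _) i)) ->
  \sum_i \sum_j F i j = 0.
Proof.
move=> H.
have E i : \sum_j F i j =
   \sum_(j < n.+1 | (j <= i)%N) F i (widen_ord (leqnSn _) j) +
   \sum_(j < n.+1 | (i <= j)%N) F i (fintype.lift ord0 j).
  rewrite (bigID (fun j : 'I_n.+2 => (j <= i)%N)) /=; congr (_ + _).
    rewrite [LHS]big_mkcond big_ord_recr /= leqNgt ltn_ord /= addr0.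
    by rewrite [RHS]big_mkcond.
  rewrite [LHS]big_mkcond big_ord_recl /= add0r [RHS]big_mkcond /=.
  by apply: eq_bigr => j _; rewrite -ltnNge.
under eq_bigr => i _ do rewrite E.
rewrite big_split /=.
rewrite [X in _ + X](_ : _ = - \sum_(i < n.+1) \sum_(j < n.+1 | (j <= i)%N)
    F i (widen_ord (leqnSn _) j)) ?subrr//.
rewrite -sumrN [RHS](eq_bigr (fun i : 'I_n.+1 =>
    \sum_(j < n.+1 | (j <= i)%N) - F i (widen_ord (leqnSn _) j)));
  last by move=> i _; rewrite sumrN.
rewrite (exchange_big_dep xpredT) //=; apply: eq_bigr => i _; apply: eq_bigr => j ij.
exact: H.
Qed.

End AlternatingSum.

Section NormalisedChains.

Definition bd (X : sSet) n : {additive freeab (smp X n.+1) -> freeab (smp X n)} :=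
  freelift (fun x : smp X n.+1 => \sum_(i < n.+2) gen (face i x) *~ (-1) ^+ i).

Definition degenerates (X : sSet) n : subgroup (freeab (smp X n)) :=
  span [set gen x | x in @degenerate X n].

Lemma bd_gen (X : sSet) n (x : smp X n.+1) :
  bd X n (gen x) = \sum_(i < n.+2) gen (face i x) *~ (-1) ^+ i.
Proof. exact: freelift_gen. Qed.

Lemma bd_degenerate (X : sSet) n c :
  degenerates X n.+1 c -> degenerates X n (bd X n c).
Proof.
apply: span_map => _ [x [i [y ->]] <-]; rewrite bd_gen.
pose j0 : 'I_n.+2 := widen_ord (leqnSn _) i.
pose j1 : 'I_n.+2 := fintype.lift ord0 i.
rewrite (bigD1 j0) //= (bigD1 j1) /=; last first.
  by rewrite -val_eqE /= /bump; lia.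
rewrite !face_degen_id ?eqxx ?orbT //= addrA.
have -> : bump 0 i = i.+1 by [].
rewrite exprS mulN1r mulrNz subrr add0r; apply: (@sg_sum _ (degenerates X n)) => j /andP[ji jSi].
apply: (@sgMz _ (degenerates X n)); apply: span_gen; exists (face j (degen i y)) => //.
apply: face_degen; first by move: ji; rewrite -val_eqE.
by move: jSi; rewrite -val_eqE.
Qed.

Lemma bdK (X : sSet) n c : bd X n (bd X n.+1 c) = 0.
Proof.
apply: (@freeab_ext _ _ (bd X n \o bd X n.+1 : {additive _ -> _})
  (\0 : {additive _ -> _})) => x /=.
rewrite bd_gen raddf_sum /=.
under eq_bigr => j _ do rewrite raddfMz bd_gen mulrz_suml.
rewrite exchange_big /=; apply: alt_sum0 => i j ij /=.
rewrite face_face // -!mulrzA -mulrNz; congr (_ *~ _).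
by rewrite /bump /= add1n exprS mulN1r mulrN mulrC.
Qed.

Definition Cgrp (X : sSet) n : zmodType := quotient (degenerates X n).
Definition Cdiff (X : sSet) n : {additive Cgrp X n.+1 -> Cgrp X n} :=
  quot_map (@bd_degenerate X n).

Lemma CdiffE (X : sSet) n c : Cdiff X n (cls _ c) = cls _ (bd X n c).
Proof. exact: (quot_mapE (@bd_degenerate X n)). Qed.

Lemma CdiffK (X : sSet) n x : Cdiff X n (Cdiff X n.+1 x) = 0.
Proof. by have [c ->] := cls_surj x; rewrite !CdiffE bdK raddf0. Qed.

Definition normalised_chains (X : sSet) : complex := Complex (@CdiffK X).

Definition pushforward (X Y : sSet) (f : hom X Y) n :
    {additive freeab (smp X n) -> freeab (smp Y n)} :=
  freelift (fun x : smp X n => gen (ntmap f n x : smp Y n)).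

Lemma pushforward_gen (X Y : sSet) (f : hom X Y) n x :
  pushforward f n (gen x) = gen (ntmap f n x : smp Y n).
Proof. exact: freelift_gen. Qed.

Lemma pushforward_degenerate (X Y : sSet) (f : hom X Y) n c :
  degenerates X n c -> degenerates Y n (pushforward f n c).
Proof.
apply: span_map => _ [x dx <-] {c}; rewrite pushforward_gen; apply: span_gen.
exists (ntmap f n x : smp Y n) => //.
case: n x dx => [//|n] x [i [y ->]]; exists i, (ntmap f n y).
by have /(congr1 (fun h => h y)) := ntmapP f (codeg i : @hom (opposite Delta) n n.+1).
Qed.

Lemma pushforward_bd (X Y : sSet) (f : hom X Y) n c :
  pushforward f n (bd X n c) = bd Y n (pushforward f n.+1 c).
Proof.
apply: (@freeab_ext _ _ (pushforward f n \o bd X n : {additive _ -> _})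
  (bd Y n \o pushforward f n.+1 : {additive _ -> _})) => x /=.
rewrite pushforward_gen !bd_gen raddf_sum; apply: eq_bigr => i _.
rewrite raddfMz /= pushforward_gen; congr (gen _ *~ _).
by have /(congr1 (fun h => h x)) := ntmapP f (coface i : @hom (opposite Delta) n.+1 n).
Qed.

Definition Cmap (X Y : sSet) (f : hom X Y) n : {additive Cgrp X n -> Cgrp Y n} :=
  quot_map (@pushforward_degenerate X Y f n).

Lemma CmapE (X Y : sSet) (f : hom X Y) n c :
  Cmap f n (cls _ c) = cls _ (pushforward f n c).
Proof. exact: (quot_mapE (@pushforward_degenerate X Y f n)). Qed.

Lemma Cmap_subproof (X Y : sSet) (f : hom X Y) n (x : Cgrp X n.+1) :
  Cmap f n (Cdiff X n x) = Cdiff Y n (Cmap f n.+1 x).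
Proof.
by have [c ->] := cls_surj x; rewrite CdiffE !CmapE CdiffE pushforward_bd.
Qed.

Definition normalised_chains_map (X Y : sSet) (f : hom X Y) :
    chain_map (normalised_chains X) (normalised_chains Y) :=
  @ChainMap (normalised_chains X) (normalised_chains Y) (Cmap f)
    (Cmap_subproof f).

Lemma normalised_chains_subproof :
  @is_functor sSet Ch normalised_chains normalised_chains_map.
Proof.
split=> [X|X Y Z g f]; apply: chain_map_ext => n x; have [c ->] := cls_surj x.
  rewrite [LHS]CmapE; apply: (congr1 (cls _)).
  apply: (@freeab_ext _ _ (pushforward (idm X) n) idfun) => y.
  by rewrite pushforward_gen.
rewrite [LHS]CmapE [RHS](_ : _ = Cmap g n (Cmap f n (cls _ c))) // !CmapE.
apply: (congr1 (cls _)).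
apply: (@freeab_ext _ _ (pushforward (cmp g f) n)
  (pushforward g n \o pushforward f n : {additive _ -> _})) => y.
rewrite [RHS](_ : _ = pushforward g n (pushforward f n (gen y))) //.
by rewrite !pushforward_gen.
Qed.

Definition Cn : functor sSet Ch := Functor normalised_chains_subproof.

End NormalisedChains.

Definition Ray (R : realType) : category.
refine (@Category {nonneg R} (fun l l' => l%:num <= l'%:num)
  (fun l => lexx l%:num) (fun l l' l'' h' h => le_trans h h') _ _ _);
  by move=> *; apply: Prop_irrelevance.
Defined.

Lemma sig_ext (T : Type) (P : T -> Prop) (x y : {t | P t}) :
  sval x = sval y -> x = y.
Proof.
case: x y => [x Px] [y Py] /= xy; rewrite -xy in Py *.
by congr exist; apply: Prop_irrelevance.
Qed.

Section FilteredNerve.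
Variable R : realType.
Implicit Types X Y Z : metric R.

(** The simplex <x_0, ..., x_n> of N(X) is a function on 'I_n.+1; the face and
    degeneracy maps are precomposition with [coface] and [codeg]. *)
Definition tup X n := 'I_n.+1 -> X.

Definition len X n (x : tup X n) : \bar R :=
  (\sum_(i < n) dist (x (widen_ord (leqnSn n) i)) (x (fintype.lift ord0 i)))%E.

Lemma dist_path X (g : nat -> X) a b : (a <= b)%N ->
  (dist (g a) (g b) <= \sum_(a <= k < b) dist (g k) (g k.+1))%E.
Proof.
elim: b => [|b IH]; first by rewrite leqn0 => /eqP ->; rewrite distxx big_geq.
rewrite leq_eqVlt => /orP[/eqP ->|]; first by rewrite distxx big_geq.
rewrite ltnS => ab; rewrite big_nat_recr //=.
by apply: le_trans (dist_tri _ (g b) _) _; rewrite leeD2r // IH.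
Qed.

Lemma len_nat X n (x : tup X n) :
  len x = (\sum_(0 <= k < n) dist (x (inord k)) (x (inord k.+1)))%E.
Proof.
rewrite big_mkord; apply: eq_bigr => i _; congr (dist (x _) (x _));
  apply: val_inj; rewrite /= inordK //; have := ltn_ord i; rewrite ?/bump; lia.
Qed.

Lemma len_monotone X m n (f : monotone m n) (x : tup X n) :
  (len (x \o f) <= len x)%E.
Proof.
rewrite !len_nat; pose h k : nat := f (inord k).
have hm k l : (k <= l)%N -> (l <= m)%N -> (h k <= h l)%N.
  by move=> kl lm; apply: mfunP; rewrite !inordK ?ltnS // (leq_trans kl).
have E p : (p <= m)%N ->
    (\sum_(0 <= k < p) dist ((x \o f) (inord k)) ((x \o f) (inord k.+1)) <=
     \sum_(h 0%N <= k < h p) dist (x (inord k)) (x (inord k.+1)))%E.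
  elim: p => [|p IH] pm; first by rewrite !big_geq.
  rewrite big_nat_recr //= [leRHS](@big_cat_nat _ _ _ (h p)) /=; [|exact: hm _ _ (leq0n p) (ltnW pm)|exact: hm _ _ (leqnSn p) pm].
  apply: leeD; first exact/IH/ltnW.
  have := @dist_path X (fun k => x (inord k)) (h p) (h p.+1) (hm _ _ _ pm).
  by rewrite /h !inord_val; apply.
apply: le_trans (E m (leqnn m)) _.
have h0 : (h 0%N <= h m)%N by apply: hm.
have hn : (h m <= n)%N by rewrite /h -ltnS ltn_ord.
rewrite [leRHS](@big_cat_nat _ _ _ (h 0%N)) //=; last exact: leq_trans h0 hn.
rewrite [X in (_ <= _ + X)%E](@big_cat_nat _ _ _ (h m)) //=.
rewrite addeC -addeA leeDl // adde_ge0 //; apply: sume_ge0 => *;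
  exact: dist_ge0.
Qed.

Lemma len_nonexpansive X Y (f : nonexpansive X Y) n (x : tup X n) :
  (len (f \o x) <= len x)%E.
Proof. by apply: lee_sum => i _; apply: nefunP. Qed.

Lemma nerve_subproof X : @is_functor (opposite Delta) Sets (tup X)
  (fun n m f => fun x : tup X n => (x \o (f : monotone m n))).
Proof. by []. Qed.
Definition nerve X : sSet := Functor (nerve_subproof X).

Lemma nerve_map_subproof X Y (f : nonexpansive X Y) (n m : opposite Delta)
    (u : hom n m) :
  @cmp Sets _ _ _ (fun x : tup X m => f \o x : tup Y m) (fmap (nerve X) u) =
  @cmp Sets _ _ _ (fmap (nerve Y) u) (fun x : tup X n => f \o x : tup Y n).
Proof. by []. Qed.
Definition nerve_map X Y (f : nonexpansive X Y) : hom (nerve X) (nerve Y) :=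
  @NatTrans _ _ (nerve X) (nerve Y) (fun n (x : tup X n) => f \o x : tup Y n)
    (nerve_map_subproof f).

Lemma nerve_functor_subproof : @is_functor (Met R) sSet nerve nerve_map.
Proof. by split=> *; apply: nattrans_ext. Qed.
Definition Nerve : functor (Met R) sSet := Functor nerve_functor_subproof.

(** The simplicial subset N(X)^{<= l}. *)
Definition tup_le X (l : {nonneg R}) n : Type :=
  {x : tup X n | (len x <= l%:num%:E)%E}.

Definition tup_le_act X l n m (f : monotone m n) (x : tup_le X l n) :
    tup_le X l m :=
  exist _ (sval x \o f) (le_trans (len_monotone f (sval x)) (svalP x)).

Lemma nerve_le_subproof X l :
  @is_functor (opposite Delta) Sets (tup_le X l) (@tup_le_act X l).
Proof. by split=> *; apply: funext => x; apply: sig_ext. Qed.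
Definition nerve_le X l : sSet := Functor (nerve_le_subproof X l).

Definition nerve_incl X l : hom (nerve_le X l) (nerve X) :=
  @NatTrans _ _ (nerve_le X l) (nerve X) (fun n (x : tup_le X l n) => sval x)
    (fun _ _ _ => erefl).

Definition tup_le_shift X l l' (h : l%:num <= l'%:num) n (x : tup_le X l n) :
    tup_le X l' n :=
  exist _ (sval x) (le_trans (svalP x)
    (eq_ind _ is_true h _ (esym (lee_fin l%:num l'%:num)))).

Lemma nerve_shift_subproof X l l' (h : l%:num <= l'%:num)
    (n m : opposite Delta) (u : hom n m) :
  @cmp Sets _ _ _ (@tup_le_shift X l l' h m) (fmap (nerve_le X l) u) =
  @cmp Sets _ _ _ (fmap (nerve_le X l') u) (@tup_le_shift X l l' h n).
Proof. by apply: funext => x; apply: sig_ext. Qed.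
Definition nerve_shift X l l' h : hom (nerve_le X l) (nerve_le X l') :=
  @NatTrans _ _ (nerve_le X l) (nerve_le X l') (@tup_le_shift X l l' h)
    (@nerve_shift_subproof X l l' h).

Lemma nerve_Ray_subproof X :
  @is_functor (Ray R) sSet (nerve_le X) (@nerve_shift X).
Proof.
by split=> *; apply: nattrans_ext => n; apply: funext => x; apply: sig_ext.
Qed.
Definition nerve_Ray X : functor (Ray R) sSet :=
  Functor (nerve_Ray_subproof X).

Definition tup_le_map X Y (f : nonexpansive X Y) l n (x : tup_le X l n) :
    tup_le Y l n :=
  exist _ (f \o sval x) (le_trans (len_nonexpansive f (sval x)) (svalP x)).

Lemma nerve_le_map_subproof X Y (f : nonexpansive X Y) l
    (n m : opposite Delta) (u : hom n m) :
  @cmp Sets _ _ _ (@tup_le_map X Y f l m) (fmap (nerve_le X l) u) =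
  @cmp Sets _ _ _ (fmap (nerve_le Y l) u) (@tup_le_map X Y f l n).
Proof. by apply: funext => x; apply: sig_ext. Qed.
Definition nerve_le_map X Y f l : hom (nerve_le X l) (nerve_le Y l) :=
  @NatTrans _ _ (nerve_le X l) (nerve_le Y l) (@tup_le_map X Y f l)
    (@nerve_le_map_subproof X Y f l).

Lemma nerve_Ray_map_subproof X Y (f : nonexpansive X Y) (l l' : Ray R)
    (h : hom l l') :
  cmp (nerve_le_map f l') (fmap (nerve_Ray X) h) =
  cmp (fmap (nerve_Ray Y) h) (nerve_le_map f l).
Proof. by apply: nattrans_ext => n; apply: funext => x; apply: sig_ext. Qed.
Definition nerve_Ray_map X Y f : nattrans (nerve_Ray X) (nerve_Ray Y) :=
  @NatTrans _ _ (nerve_Ray X) (nerve_Ray Y) (nerve_le_map f)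
    (@nerve_Ray_map_subproof X Y f).

Lemma Nerve_le_subproof :
  @is_functor (Met R) (functor_category (Ray R) sSet) nerve_Ray nerve_Ray_map.
Proof.
by split=> *; apply: nattrans_ext => l; apply: nattrans_ext => n;
  apply: funext => x; apply: sig_ext.
Qed.
Definition Nerve_le : functor (Met R) (functor_category (Ray R) sSet) :=
  Functor Nerve_le_subproof.

End FilteredNerve.

Record subcomplex (C : complex) := Subcomplex {
  scgrp :> forall n, subgroup (C n);
  scgrpP : forall n x, scgrp n.+1 x -> scgrp n (cdiff C x) }.

Section Subcomplexes.
Variable C : complex.
Implicit Types A B : subcomplex C.

Definition sc_diff A n : {additive sub (A n.+1) -> sub (A n)} :=
  sub_map (@scgrpP C A n).
Lemma sc_diffK A n x : sc_diff A n (sc_diff A n.+1 x) = 0.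
Proof. by apply: val_inj; rewrite /= cdiffK. Qed.
Definition subcx A : complex := Complex (@sc_diffK A).

(** A / B is meant for B contained in A; in general this is A / (A meet B). *)
Definition relgrp A B n : subgroup (sub (A n)) :=
  preim_sg (sub_incl (A n)) (B n).
Lemma relgrpP A B n x : relgrp A B n.+1 x -> relgrp A B n (sc_diff A n x).
Proof. exact: scgrpP. Qed.
Definition qc_diff A B n :
    {additive quotient (relgrp A B n.+1) -> quotient (relgrp A B n)} :=
  quot_map (@relgrpP A B n).
Lemma qc_diffE A B n x : qc_diff A B n (cls _ x) = cls _ (sc_diff A n x).
Proof. exact: (quot_mapE (@relgrpP A B n)). Qed.
Lemma qc_diffK A B n x : qc_diff A B n (qc_diff A B n.+1 x) = 0.
Proof. by have [a ->] := cls_surj x; rewrite !qc_diffE sc_diffK raddf0. Qed.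
Definition quotcx A B : complex := Complex (@qc_diffK A B).

Lemma scgrp_sub A B (AB : forall n x, A n x -> B n x) n x : A n x ->
  B n ((idfun : {additive C n -> C n}) x).
Proof. exact: AB. Qed.
Lemma sc_incl_subproof A B (AB : forall n x, A n x -> B n x) n (x : subcx A n.+1) :
  sub_map (@scgrp_sub A B AB n) (cdiff (subcx A) x) =
  cdiff (subcx B) (sub_map (@scgrp_sub A B AB n.+1) x).
Proof. exact: val_inj. Qed.
Definition sc_incl A B AB : chain_map (subcx A) (subcx B) :=
  @ChainMap (subcx A) (subcx B) _ (@sc_incl_subproof A B AB).
End Subcomplexes.

Section SubcomplexMaps.
Variables (C D : complex) (f : chain_map C D).

Lemma image_subproof n x : im_sg (f n.+1) x -> im_sg (f n) (cdiff D x).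
Proof. by move=> [y ->]; exists (cdiff C y); rewrite cmapP. Qed.
Definition image : subcomplex D := Subcomplex image_subproof.

Lemma im_self n x : im_sg (f n) (f n x). Proof. by exists x. Qed.
Lemma corestriction_subproof n (x : C n.+1) :
  cores (@im_self n) (cdiff C x) =
  cdiff (subcx image) (cores (@im_self n.+1) x).
Proof. by apply: val_inj; rewrite /= cmapP. Qed.
Definition corestriction : chain_map C (subcx image) :=
  @ChainMap C (subcx image) _ corestriction_subproof.

Variables (A : subcomplex C) (A' : subcomplex D).
Hypothesis fA : forall n x, A n x -> A' n (f n x).

Lemma subcx_map_subproof n (x : subcx A n.+1) :
  sub_map (@fA n) (cdiff (subcx A) x) =
  cdiff (subcx A') (sub_map (@fA n.+1) x).
Proof. by apply: val_inj; rewrite /= cmapP. Qed.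
Definition subcx_map : chain_map (subcx A) (subcx A') :=
  @ChainMap (subcx A) (subcx A') _ subcx_map_subproof.

Variables (B : subcomplex C) (B' : subcomplex D).
Hypothesis fB : forall n x, B n x -> B' n (f n x).

Lemma quotcx_map_rel n x : relgrp A B n x -> relgrp A' B' n (sub_map (@fA n) x).
Proof. exact: fB. Qed.
Lemma quotcx_mapE n x :
  quot_map (@quotcx_map_rel n) (cls _ x) = cls _ (sub_map (@fA n) x).
Proof. exact: (quot_mapE (@quotcx_map_rel n)). Qed.
Lemma quotcx_map_subproof n (x : quotcx A B n.+1) :
  quot_map (@quotcx_map_rel n) (cdiff (quotcx A B) x) =
  cdiff (quotcx A' B') (quot_map (@quotcx_map_rel n.+1) x).
Proof.
have [a ->] := cls_surj x; rewrite [cdiff (quotcx A B) _]qc_diffE.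
rewrite !quotcx_mapE [cdiff (quotcx A' B') _]qc_diffE.
by apply: (congr1 (cls _)); apply: (subcx_map_subproof a).
Qed.
Definition quotcx_map : chain_map (quotcx A B) (quotcx A' B') :=
  @ChainMap (quotcx A B) (quotcx A' B') _ quotcx_map_subproof.

End SubcomplexMaps.

Record filtered (R : realType) := Filtered {
  fcx :> complex;
  fil : {nonneg R} -> subcomplex fcx;
  fil_mono : forall l l' : {nonneg R}, l%:num <= l'%:num ->
    forall n x, fil l n x -> fil l' n x }.

Section FilLt.
Variables (R : realType) (C : filtered R) (l : {nonneg R}).

(** The union of the [fil C l'] for [l' < l]; the first disjunct only matters
    for [l = 0], where the union of no subcomplexes is the zero subcomplex. *)
Definition fil_lt_set n : set (C n) :=
  [set x | x = 0 \/ exists2 l' : {nonneg R}, l'%:num < l%:num & fil C l' n x].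

Lemma fil_lt0 n : @fil_lt_set n 0. Proof. by left. Qed.
Lemma fil_ltB n x y :
  @fil_lt_set n x -> @fil_lt_set n y -> @fil_lt_set n (x - y).
Proof.
move=> [->|[l1 h1 x1]] [->|[l2 h2 y2]]; rewrite ?subr0 ?sub0r; first by left.
- by right; exists l2 => //; apply: sgN.
- by right; exists l1.
- right; case: (leP l1%:num l2%:num) => h.
    by exists l2 => //; apply: sgB => //; apply: fil_mono x1.
  by exists l1 => //; apply: sgB => //; apply: fil_mono y2; apply: ltW.
Qed.
Lemma fil_ltP n x : Subgroup (@fil_lt0 n.+1) (@fil_ltB n.+1) x ->
  Subgroup (@fil_lt0 n) (@fil_ltB n) (cdiff C x).
Proof.
move=> [->|[l' h x']]; first by left; rewrite raddf0.
by right; exists l' => //; apply: scgrpP.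
Qed.
Definition fil_lt : subcomplex C := Subcomplex fil_ltP.

Definition graded : complex := quotcx (fil C l) fil_lt.
End FilLt.

Record filtered_map (R : realType) (C D : filtered R) := FilteredMap {
  fcmap :> chain_map C D;
  fcmapP : forall l n x, fil C l n x -> fil D l n (fcmap n x) }.

Section FilteredCategory.
Variable R : realType.

Lemma filtered_map_ext (C D : filtered R) (f g : filtered_map C D) :
  fcmap f = fcmap g -> f = g.
Proof.
case: f g => [f fP] [g gP] /= fg; rewrite -fg in gP *.
by congr FilteredMap; apply: Prop_irrelevance.
Qed.

Definition filtered_id (C : filtered R) : filtered_map C C :=
  @FilteredMap R C C (chain_id C) (fun _ _ _ h => h).
Definition filtered_cmp (C D E : filtered R) (g : filtered_map D E)
    (f : filtered_map C D) : filtered_map C E :=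
  @FilteredMap R C E (chain_cmp g f)
    (fun l n x h => fcmapP g (fcmapP f h)).

Definition FCh : category.
refine (@Category (filtered R) (@filtered_map R) filtered_id filtered_cmp
  _ _ _); by move=> *; apply: filtered_map_ext; apply: chain_map_ext.
Defined.

Lemma fil_lt_map (C D : filtered R) (f : filtered_map C D) l n x :
  fil_lt C l n x -> fil_lt D l n (f n x).
Proof.
move=> [->|[l' h x']]; first by left; rewrite raddf0.
by right; exists l' => //; apply: fcmapP.
Qed.

Definition graded_map l (C D : filtered R) (f : filtered_map C D) :
    chain_map (graded C l) (graded D l) :=
  quotcx_map (@fcmapP R C D f l) (@fil_lt_map C D f l).

Lemma graded_mapE l (C D : filtered R) (f : filtered_map C D) n x :
  graded_map l f n (cls _ x) = cls _ (sub_map (@fcmapP R C D f l n) x).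
Proof. exact: (quotcx_mapE (@fcmapP R C D f l) (@fil_lt_map C D f l)). Qed.

Lemma gr_subproof l :
  @is_functor FCh Ch (fun C => graded C l) (@graded_map l).
Proof.
split=> [C|C D E g f]; apply: chain_map_ext => n a; have [x ->] := cls_surj a.
  by rewrite [LHS]graded_mapE; apply: (congr1 (cls _)); apply: val_inj.
rewrite [RHS](_ : _ = graded_map l g n (graded_map l f n (cls _ x))) //.
by rewrite !graded_mapE; apply: (congr1 (cls _)); apply: val_inj.
Qed.
Definition gr l : functor FCh Ch := Functor (gr_subproof l).

End FilteredCategory.

Section PersistentMagnitude.
Variable R : realType.
Implicit Types (X Y : metric R) (l : {nonneg R}).

Definition chains X : complex := Cn (Nerve R X).
Definition chains_map X Y (f : nonexpansive X Y) :
    chain_map (chains X) (chains Y) :=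
  fmap Cn (@fmap (Met R) sSet (Nerve R) X Y f).

(** F_l C(X), the chains C(N(X)^{<= l}) inside C(X) = C(N(X)). *)
Definition FC X l : subcomplex (chains X) := image (fmap Cn (nerve_incl X l)).

Definition to_FC X l : chain_map (Cn (nerve_le X l)) (subcx (FC X l)) :=
  corestriction (fmap Cn (nerve_incl X l)).

Lemma FC_mono X l l' : l%:num <= l'%:num ->
  forall n x, FC X l n x -> FC X l' n x.
Proof.
move=> h n x [y ->]; exists (fmap Cn (nerve_shift X h) n y).
have -> : nerve_incl X l = cmp (nerve_incl X l') (nerve_shift X h).
  by apply: nattrans_ext.
by rewrite (functor_cmp (fmapP Cn)).
Qed.

Lemma FC_map X Y (f : nonexpansive X Y) l n x :
  FC X l n x -> FC Y l n (chains_map f n x).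
Proof.
move=> [y ->]; exists (fmap Cn (nerve_le_map f l) n y).
have /(congr1 (fun u => fmap Cn u n y)) :
    @cmp sSet _ _ _ (nerve_map f) (nerve_incl X l) =
    @cmp sSet _ _ _ (nerve_incl Y l) (nerve_le_map f l).
  by apply: nattrans_ext.
by rewrite !(functor_cmp (fmapP Cn)).
Qed.

Definition filtered_chains X : filtered R := Filtered (@FC_mono X).

Lemma filtered_chains_map_subproof X Y (f : nonexpansive X Y) l n x :
  fil (filtered_chains X) l n x ->
  fil (filtered_chains Y) l n (chains_map f n x).
Proof. exact: FC_map. Qed.
Definition filtered_chains_map X Y f :
    filtered_map (filtered_chains X) (filtered_chains Y) :=
  @FilteredMap R (filtered_chains X) (filtered_chains Y) (chains_map f)
    (@filtered_chains_map_subproof X Y f).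

Lemma CF_subproof :
  @is_functor (Met R) (FCh R) filtered_chains filtered_chains_map.
Proof.
split=> [X|X Y Z g f]; apply: filtered_map_ext.
  exact: (functor_id (fmapP (Cn \O Nerve R))).
exact: (functor_cmp (fmapP (Cn \O Nerve R))).
Qed.
Definition CF : functor (Met R) (FCh R) := Functor CF_subproof.

Lemma FC_Ray_subproof X : @is_functor (Ray R) Ch (fun l => subcx (FC X l))
  (fun l l' h => sc_incl (FC_mono h)).
Proof. by split=> *; apply: chain_map_ext => n x; apply: val_inj. Qed.
Definition FC_Ray X : functor (Ray R) Ch := Functor (FC_Ray_subproof X).

Lemma FC_Ray_map_subproof X Y (f : nonexpansive X Y) (l l' : Ray R)
    (h : hom l l') :
  @cmp Ch _ _ _ (subcx_map (@FC_map X Y f l')) (fmap (FC_Ray X) h) =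
  @cmp Ch _ _ _ (fmap (FC_Ray Y) h) (subcx_map (@FC_map X Y f l)).
Proof. by apply: chain_map_ext => n x; apply: val_inj. Qed.
Definition FC_Ray_map X Y (f : nonexpansive X Y) : nattrans (FC_Ray X) (FC_Ray Y) :=
  @NatTrans (Ray R) Ch (FC_Ray X) (FC_Ray Y)
    (fun l => subcx_map (@FC_map X Y f l)) (FC_Ray_map_subproof f).

Definition PH n X : functor (Ray R) Ab := Hn n \O FC_Ray X.
Definition PH_map n X Y (f : nonexpansive X Y) : nattrans (PH n X) (PH n Y) :=
  postcomp_nt (Hn n) (FC_Ray_map f).

Definition FC_lt X l : subcomplex (chains X) := fil_lt (filtered_chains X) l.

Lemma FC_lt_map X Y (f : nonexpansive X Y) l n x :
  FC_lt X l n x -> FC_lt Y l n (chains_map f n x).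
Proof. exact: (fil_lt_map (filtered_chains_map f)). Qed.

Definition MC l X : complex := quotcx (FC X l) (FC_lt X l).
Definition MC_map l X Y (f : nonexpansive X Y) : chain_map (MC l X) (MC l Y) :=
  quotcx_map (@FC_map X Y f l) (@FC_lt_map X Y f l).

Definition MH n l X : zmodType := Hn n (MC l X).
Definition MH_map n l X Y (f : nonexpansive X Y) :
    {additive MH n l X -> MH n l Y} :=
  fmap (Hn n) (MC_map l f).

End PersistentMagnitude.

(* Main.v *)
(** Everything is transported along functors, so functoriality and part (2) are
    formal; in (2) the graded piece of the filtered complex is by construction
    the magnitude complex. The content of (1) is that the chains of
    N(X)^{<= l} map isomorphically onto F_l C(X), a subcomplex of C(X): a
    levelwise injective simplicial map reflects degenerate simplices, hence
    stays injective on normalised chains. *)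

Require Import Defs.
From HB Require Import structures.
From mathcomp Require Import all_boot all_order all_algebra.
From mathcomp Require Import interval_inference boolp classical_sets reals.
From mathcomp Require Import freeg.
(* mathcomp's [vector] shadows [hom]. *)
Import Defs.

Set Implicit Arguments.
Unset Strict Implicit.
Unset Printing Implicit Defensive.

Import GRing.Theory.

Local Open Scope ring_scope.
Local Open Scope function_scope.

Lemma additive_bij_inverse (U V : zmodType) (f : {additive U -> V}) :
    injective f -> (forall y, exists x, y = f x) ->
  exists g : {additive V -> U}, cancel f g /\ cancel g f.
Proof.
move=> f_inj f_surj; have [g gE] := choice f_surj.
have gK : cancel g f by move=> y; rewrite -gE.
have fK : cancel f g by move=> x; apply: f_inj.
pose gA := GRing.isZmodMorphism.Build V U g (can2_zmod_morphism fK gK).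
pose G : {additive V -> U} := HB.pack g gA.
by exists G.
Qed.

(** The degreewise inverses form a chain map because [f] commutes with the differentials and is
    injective. *)
Lemma chain_bij_is_iso (C D : complex) (f : chain_map C D) :
    (forall n, injective (f n)) -> (forall n y, exists x, y = f n x) ->
  @is_iso Ch C D f.
Proof.
move=> f_inj f_surj.
have inv n := cid (additive_bij_inverse (f_inj n) (f_surj n)).
pose g n : {additive D n -> C n} := sval (inv n).
have fK n : cancel (f n) (g n) by have [] := svalP (inv n).
have gK n : cancel (g n) (f n) by have [] := svalP (inv n).
have g_chain n y : g n (cdiff D y) = cdiff C (g n.+1 y).
  by apply: (f_inj n); rewrite gK cmapP gK.
exists (ChainMap g_chain).
by split; apply: chain_map_ext => n x; [apply: fK | apply: gK].
Qed.

Lemma functor_is_iso (C D : category) (F : functor C D) (A B : C)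
    (f : hom A B) : is_iso f -> is_iso (fmap F f).
Proof.
move=> [g [gf fg]]; exists (fmap F g).
by rewrite -!(functor_cmp (fmapP F)) gf fg !(functor_id (fmapP F)).
Qed.

(** Inverses chosen object by object are automatically natural: compose the naturality square of [a]
    with them on both sides. *)
Lemma natiso_is_iso (C D : category) (F G : functor C D) (a : nattrans F G) :
  is_natiso a -> @is_iso (functor_category C D) F G a.
Proof.
move=> a_iso; pose b A := sval (cid (a_iso A)).
have ba A : cmp (b A) (a A) = idm (F A) by have [] := svalP (cid (a_iso A)).
have ab A : cmp (a A) (b A) = idm (G A) by have [] := svalP (cid (a_iso A)).
have b_nat A B (f : hom A B) : cmp (b B) (fmap G f) = cmp (fmap F f) (b A).
  rewrite -[fmap G f]cmp_idr -ab [cmp (fmap G f) _]cmpA -ntmapP.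
  by rewrite cmpA cmpA ba cmp_idl.
exists (NatTrans b_nat).
by split; apply: nattrans_ext => A; [apply: ba | apply: ab].
Qed.

Section InjectiveSimplicialMap.
Variables (X Y : sSet) (f : hom X Y).
Hypothesis f_inj : forall n, injective (ntmap f n : smp X n -> smp Y n).

(** If f(x) = s_i(y), then y = d_i s_i(y) = f(d_i x), so f(x) = f(s_i d_i x), and injectivity gives
    x = s_i d_i x. *)
Lemma degenerate_reflect n (x : smp X n) :
  degenerate (ntmap f n x : smp Y n) -> degenerate x.
Proof.
case: n x => [//|n] x [i [y fx]].
pose j := widen_ord (leqnSn _) i.
exists i, (face j x); apply: f_inj.
have /(congr1 (fun h => h (face j x))) /= f_degen :=
  ntmapP f (codeg i : @hom (opposite Delta) n n.+1).
have /(congr1 (fun h => h x)) /= f_face :=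
  ntmapP f (coface j : @hom (opposite Delta) n.+1 n).
rewrite [RHS]f_degen [X in fmap Y _ X]f_face [X in fmap Y _ (fmap Y _ X)]fx.
by rewrite -/(face j (degen i y)) face_degen_id ?eqxx.
Qed.

(* The retraction of the induced map sends a simplex outside the image of [f]
   to 0; it is only degreewise, not a chain map. *)
Lemma Cmap_inj n : injective (Cmap f n).
Proof.
pose P (y : smp Y n) (c : freeab (smp X n)) :=
  (forall x, ntmap f n x = y -> c = gen x) /\
  ((forall x, ntmap f n x <> y) -> c = 0).
have exP y : exists c, P y c.
  have [[x <-]|nx] := EM (exists x, ntmap f n x = y).
    (* The preimage is unique by injectivity, so the two clauses of [P] are consistent. *)
    by exists (gen x); split=> [z /f_inj -> //|/(_ x)].
  by exists 0; split=> [x fx|//]; case: nx; exists x.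
have [r rP] := choice exP.
(* The retraction descends to normalised chains: a degenerate simplex in the image has a degenerate
   preimage, and any other is sent to 0. *)
have r_degen c : degenerates Y n c -> degenerates X n (freelift r c).
  apply: span_map => _ [y dy <-]; rewrite /= freelift_gen.
  have [r_im r0] := rP y.
  have [[x fx]|nx] := EM (exists x, ntmap f n x = y); last first.
    rewrite r0 => [|x fx]; first exact: (sg0 (degenerates X n)).
    by apply: nx; exists x.
  rewrite (r_im x fx); apply: span_gen; exists x => //.
  by apply: degenerate_reflect; rewrite fx.
apply: (can_inj (g := quot_map r_degen)) => a.
have [c ->] := cls_surj a; rewrite CmapE quot_mapE; apply: (congr1 (cls _)).
apply: (@freeab_ext _ _ (freelift r \o pushforward f n : {additive _ -> _})
  idfun) => x /=.
by rewrite pushforward_gen freelift_gen ((rP (ntmap f n x)).1 x).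
Qed.

End InjectiveSimplicialMap.

Section PersistentHomology.
Variable R : realType.

(** Surjectivity is built in, since [FC] is an image. For injectivity, [val] turns the map into the
    one induced by the levelwise injective [nerve_incl]. *)
Lemma to_FC_is_iso (X : metric R) (l : {nonneg R}) :
  @is_iso Ch _ _ (to_FC X l).
Proof.
apply: chain_bij_is_iso => n.
  have incl_inj m : injective (ntmap (nerve_incl X l) m :
      smp (nerve_le X l) m -> smp (nerve X) m) by move=> x y; apply: sig_ext.
  by move=> x y /(congr1 val) /(Cmap_inj incl_inj).
by move=> y; have [x yx] := subE y; exists x; apply: val_inj.
Qed.

(** The maps restrict those of [chains], so the functor laws of [Cn \O Nerve R] carry over through
    the injective [val]. *)
Lemma FC_Ray_is_functor :
  @is_functor (Met R) (functor_category (Ray R) Ch) (@FC_Ray R) (@FC_Ray_map R).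
Proof.
split=> [X|X Y Z g f]; apply: nattrans_ext => l; apply: chain_map_ext => n x;
  apply: val_inj.
  exact: (congr1 (fun h : chain_map _ _ => h n (val x))
    (functor_id (fmapP (Cn \O Nerve R)) X)).
exact: (congr1 (fun h : chain_map _ _ => h n (val x))
    (functor_cmp (fmapP (Cn \O Nerve R)) g f)).
Qed.

(** Naturality in the scale: inside [chains X] both composites are induced by [nerve_incl X l]. *)
Lemma to_FC_shift (X : metric R) (l l' : Ray R) (h : hom l l') :
  @cmp Ch _ _ _ (to_FC X l') (fmap Cn (nerve_shift X h)) =
  @cmp Ch _ _ _ (fmap (FC_Ray X) h) (to_FC X l).
Proof.
apply: chain_map_ext => n x; apply: val_inj.
have /(congr1 (fun u => fmap Cn u n x)) :
    @cmp sSet _ _ _ (nerve_incl X l') (nerve_shift X h) = nerve_incl X l.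
  by apply: nattrans_ext.
by rewrite (functor_cmp (fmapP Cn)).
Qed.

(** Naturality in the space, by the same comparison inside [chains Y]. *)
Lemma to_FC_natural (X Y : metric R) (f : nonexpansive X Y) (l : Ray R) :
  @cmp Ch _ _ _ (to_FC Y l) (fmap Cn (nerve_le_map f l)) =
  @cmp Ch _ _ _ (FC_Ray_map f l) (to_FC X l).
Proof.
apply: chain_map_ext => n x; apply: val_inj.
have /(congr1 (fun u => fmap Cn u n x)) :
    @cmp sSet _ _ _ (nerve_incl Y l) (nerve_le_map f l) =
    @cmp sSet _ _ _ (nerve_map f) (nerve_incl X l).
  by apply: nattrans_ext.
by rewrite !(functor_cmp (fmapP Cn)).
Qed.

(** The two maps differ only in their proofs that the filtration is respected, so they agree on
    representatives. *)
Lemma graded_mapE_MC l (X Y : metric R) (f : nonexpansive X Y) :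
  graded_map l (filtered_chains_map f) = MC_map l f.
Proof.
apply: chain_map_ext => n a; have [x ->] := cls_surj a.
rewrite graded_mapE [RHS]quotcx_mapE.
by apply: (congr1 (cls _)); apply: val_inj.
Qed.

Lemma MH_is_functor n l :
  @is_functor (Met R) Ab (MH n l) (fun X Y f => MH_map n l f).
Proof.
have [fid fcmp] := fmapP (Hn n \O gr l \O CF R).
split=> [X|X Y Z g f]; rewrite /MH_map -!graded_mapE_MC.
  exact: (fid X).
exact: (fcmp X Y Z g f).
Qed.

End PersistentHomology.

Theorem theorem7p1 (R : realType) (Om : signature) (U : set (inference Om))
    (hU : quantitative_theory U)
    (Free : functor (Met R) (Mod R U)) (hFree : left_adjoint Free (forget R U))
    (n : nat) :
  let T : functor (Met R) (Met R) := forget R U \O Free in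
  (exists PHU : @is_functor (Met R) (functor_category (Ray R) Ab)
                  (fun A => PH n (T A)) (fun A B f => PH_map n (fmap T f)),
     exists alpha :
         nattrans (postcomp (Ray R) (Hn n \O Cn) \O Nerve_le R \O T)
                  (Functor PHU),
       is_natiso alpha /\
       (forall (A : metric R) (l : {nonneg R}),
          ntmap (ntmap alpha A) l = fmap (Hn n) (to_FC (T A) l)))
  /\
  (forall l : {nonneg R},
     exists MHU : @is_functor (Met R) Ab
                    (fun A => MH n l (T A)) (fun A B f => MH_map n l (fmap T f)),
     exists beta : nattrans (Hn n \O gr l \O CF R \O T) (Functor MHU),
       is_natiso beta /\
       (forall A : metric R, ntmap beta A = @idm Ab (MH n l (T A)))).
Proof.
move=> T; split; last first.
  move=> l; pose F := Hn n \O gr l \O CF R \O T.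
  pose G := Functor (MH_is_functor n l) \O T.
  (* On objects [F] and [G] agree by conversion, so identities serve as components. *)
  have nat A B (f : hom A B) :
      @cmp Ab _ _ _ (idm (F B)) (fmap F f) = cmp (fmap G f) (idm (F A)).
    by rewrite cmp_idl cmp_idr /= /MH_map -graded_mapE_MC.
  exists (fmapP G), (@NatTrans _ _ F (Functor (fmapP G)) _ nat); split=> // A.
  by exists (idm (F A)); rewrite cmp_idl.
pose G := postcomp (Ray R) (Hn n) \O Functor (FC_Ray_is_functor R) \O T.
exists (fmapP G).
have shift A (l l' : Ray R) (h : hom l l') :
    cmp (fmap (Hn n) (to_FC (T A) l'))
        (fmap ((Hn n \O Cn) \O Nerve_le R (T A)) h) =
    cmp (fmap (PH n (T A)) h) (fmap (Hn n) (to_FC (T A) l)).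
  have := congr1 (fmap (Hn n)) (to_FC_shift (T A) h).
  by rewrite !(functor_cmp (fmapP (Hn n))); apply.
pose alpha A : nattrans ((Hn n \O Cn) \O Nerve_le R (T A)) (PH n (T A)) :=
  @NatTrans _ _ ((Hn n \O Cn) \O Nerve_le R (T A)) (PH n (T A))
    (fun l => fmap (Hn n) (to_FC (T A) l)) (shift A).
have nat A B (f : hom A B) :
    nt_cmp (alpha B)
      (fmap (postcomp (Ray R) (Hn n \O Cn) \O Nerve_le R \O T) f) =
    nt_cmp (PH_map n (fmap T f)) (alpha A).
  apply: nattrans_ext => l.
  have := congr1 (fmap (Hn n)) (to_FC_natural (fmap T f) l).
  by rewrite !(functor_cmp (fmapP (Hn n))); apply.
exists (@NatTrans _ _ (postcomp (Ray R) (Hn n \O Cn) \O Nerve_le R \O T)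
  (Functor (fmapP G)) alpha nat); split=> // A.
(* An isomorphism of persistent groups can be checked at each scale, where [Hn n] preserves the
   isomorphism [to_FC]. *)
apply: natiso_is_iso => l.
exact: (functor_is_iso (Hn n) (to_FC_is_iso (T A) l)).
Qed.
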